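(* Let $\Delta$ be a normal subgroup of a group $\Gamma$. If $(G,D)$ is a direct limit of a directed system of simplicial $\Gamma$-groups with simplicial $\Gamma$-bases stabilized by $\Delta$ in the category $\mathbf{OG}^D_\Gamma$, then $(G,D)$ has an ordered $\Gamma$-group extension $(H,u)$ by $(\mathbb Z[\Gamma/\Delta],\Delta)$ such that $H$ satisfies (SDP$_\Delta$) and such that $\Delta\subseteq\mathrm{Stab}(H)$.
   Context: Ordered groups. $\mathbb Z^+[\Gamma]\subseteq\mathbb Z[\Gamma]$ is the set of elements with all coefficients nonnegative. An ordered $\Gamma$-group is a left $\mathbb Z[\Gamma]$-module $G$ with a partial order such that $g_1\ge g_2$ implies $g_1+h\ge g_2+h$ and $\gamma g_1\ge\gamma g_2$ for $\gamma\in\Gamma$; $G^+=\{x\ge0\}$. $G$ is directed if any two elements have a common upper bound. $\mathrm{Stab}(H)=\{\gamma\in\Gamma:\gamma x=x\ \forall x\in H\}$. An order-unit is $u\in G^+$ such that for every $x\in G$ there is a nonzero $a\in\mathbb Z^+[\Gamma]$ with $x\le au$. A generating interval is a subset $D\subseteq G^+$ containing $0$ which is upwards directed, convex ($x\le z\le y$, $x,y\in D$ implies $z\in D$), and such that every element of $G^+$ is a finite sum of elements $ad$, $a\in\mathbb Z^+[\Gamma]$, $d\in D$. $[0,u]=\{x:0\le x\le u\}$. $\mathbf{OG}^D_\Gamma$: pairs $(G,D)$, $G$ an ordered $\Gamma$-group and $D$ a generating interval, with $\mathbb Z[\Gamma]$-homomorphisms $f:(G,D)\to(H,E)$ with $f(G^+)\subseteq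 H^+$ and $f(D)\subseteq E$. $\mathbb Z[\Gamma/\Delta]$ is the permutation module on left cosets, ordered with cone $\mathbb Z^+[\Gamma/\Delta]$ and with order-unit the coset $\Delta$; $\pi:\mathbb Z[\Gamma]\to\mathbb Z[\Gamma/\Delta]$ is the left module map $1\mapsto\Delta$. A finite set $X=\{x_1,\dots,x_n\}$ in a $\Gamma$-group (left $\mathbb Z[\Gamma]$-module) $G$ is a simplicial $\Gamma$-basis stabilized by $\Delta$ if each $x_i$ has stabilizer $\Delta$ and, for all $a_i,b_i\in\mathbb Z[\Gamma]$ with $\pi(a_i),\pi(b_i)\in\mathbb Z^+[\Gamma/\Delta]$, $\sum a_ix_i=\sum b_ix_i$ iff $a_i-b_i\in\ker\pi$ for all $i$; its cone is $\{\sum a_ix_i:\pi(a_i)\in\mathbb Z^+[\Gamma/\Delta]\}$. A simplicial $\Gamma$-group is a $\Gamma$-group ordered by, and directed under, the cone of such a finite simplicial $\Gamma$-basis, or the zero group (with basis $\varnothing$, which counts as stabilized by any subgroup). (SDP$_\Delta$) for a directed ordered $\Gamma$-group $H$: if $\sum_{i=1}^n a_ix_i=0$ with $a_i\in\mathbb Z[\Gamma]$, $x_i\in H^+$, then there are a positive integer $m$, $b_{ij}\in\mathbb Z^+[\Gamma]$, $y_j\in H^+$ with $x_i=\sum_{j=1}^m b_{ij}y_j$ for all $i$ and $\sum_{i=1}^n\pi(a_ib_{ij})=0$ for all $j$. Extensions. For ordered $\Gamma$-groups $G,H,K$, with $D$ a generating interval of $G$ and $u,v$ order-units of $H,K$,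 $(H,u)$ is an ordered $\Gamma$-group extension of $(G,D)$ by $(K,v)$ if there are order-preserving $\mathbb Z[\Gamma]$-homomorphisms $i:G\to H$ injective and $p:H\to K$ surjective with $i(G)=\ker p$, $i^{-1}(H^+)=G^+$, $p(H^+)=K^+$, $p(u)=v$, and $i^{-1}([0,u])=D$. *)

(* Defs.v *)
From HB Require Import structures.
From mathcomp Require Import all_boot all_order all_algebra.
From mathcomp Require Import finmap monalg.
From mathcomp Require Import boolp classical_sets.

Set Implicit Arguments.
Unset Strict Implicit.
Unset Printing Implicit Defensive.

Import Order.TTheory GRing.Theory Num.Theory.

Local Open Scope classical_set_scope.
Local Open Scope ring_scope.

(* [{malg int[K]}] is the free abelian group on [K].  The library only makes it
   a ring when [K] is a monoid without nontrivial units, hence [conv], the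
   biadditive extension of a binary operation on basis elements.  It is used
   with the product of a group and with the action of a group on cosets. *)
Section Convolution.
Variables (K1 K2 K3 : choiceType) (op : K1 -> K2 -> K3).

Definition conv (a : {malg int[K1]}) (b : {malg int[K2]}) : {malg int[K3]} :=
  \sum_(g <- msupp a) \sum_(x <- msupp b) << a@_g * b@_x *g op g x >>.

Lemma convEw (d1 : {fset K1}) (d2 : {fset K2}) a b :
  fsubset (msupp a) d1 -> fsubset (msupp b) d2 ->
  conv a b = \sum_(g <- d1) \sum_(x <- d2) << a@_g * b@_x *g op g x >>.
Proof.
move=> le_d1 le_d2; rewrite /conv -(big_fset_incl _ le_d1) /=.
  apply/eq_bigr => g _; apply/big_fset_incl => // x _ /mcoeff_outdom ->.
  by rewrite mulr0 monalgU0.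
move=> g _ /mcoeff_outdom ->.
by apply: big1 => x _; rewrite mul0r monalgU0.
Qed.

Fact conv_zmod_r a : zmod_morphism (conv a).
Proof.
move=> b1 b2; pose d := fsetU (msupp b1) (msupp b2).
rewrite !(@convEw (msupp a) d) ?fsubset_refl ?fsubsetUl ?fsubsetUr //;
  last exact: msuppB_le.
rewrite -sumrB; apply: eq_bigr => g _; rewrite -sumrB; apply: eq_bigr => x _.
by rewrite mcoeffB mulrBr monalgUB.
Qed.

Fact conv_zmod_l b : zmod_morphism (conv^~ b).
Proof.
move=> a1 a2; pose d := fsetU (msupp a1) (msupp a2).
rewrite /= !(@convEw d (msupp b)) ?fsubset_refl ?fsubsetUl ?fsubsetUr //;
  last exact: msuppB_le.
rewrite -sumrB; apply: eq_bigr => g _; rewrite -sumrB; apply: eq_bigr => x _.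
by rewrite mcoeffB mulrBl monalgUB.
Qed.

HB.instance Definition _ a := GRing.isZmodMorphism.Build
  {malg int[K2]} {malg int[K3]} (conv a) (conv_zmod_r a).

Lemma convDl a1 a2 b : conv (a1 + a2) b = conv a1 b + conv a2 b.
Proof.
have convBl := conv_zmod_l b.
have conv0l : conv 0 b = 0 by rewrite -[in LHS](subrr 0) convBl subrr.
by rewrite -{1}[a2]opprK convBl -[- a2]sub0r convBl conv0l sub0r opprK.
Qed.

Lemma conv_suml (I : Type) (r : seq I) (F : I -> {malg int[K1]}) b :
  conv (\sum_(i <- r) F i) b = \sum_(i <- r) conv (F i) b.
Proof.
elim: r => [|i r IHr]; last by rewrite !big_cons convDl IHr.
by rewrite !big_nil; apply: (addrI (conv 0 b)); rewrite -convDl !addr0.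
Qed.

Lemma conv_sumr (I : Type) (r : seq I) a (F : I -> {malg int[K2]}) :
  conv a (\sum_(i <- r) F i) = \sum_(i <- r) conv a (F i).
Proof. exact: raddf_sum. Qed.

Lemma convUU c1 c2 g x :
  conv << c1 *g g >> << c2 *g x >> = << c1 * c2 *g op g x >>.
Proof.
rewrite (@convEw [fset g]%fset [fset x]%fset) ?msuppU_le //.
by rewrite !big_seq_fset1 !mcoeffUU.
Qed.
End Convolution.

Lemma conv1l (K1 K2 : choiceType) (op : K1 -> K2 -> K2) e b :
  left_id e op -> conv op << e >> b = b.
Proof.
move=> op1; rewrite {1}[b]monalgE conv_sumr [RHS]monalgE.
by apply: eq_bigr => x _; rewrite convUU op1 mul1r.
Qed.

Lemma conv1r (K1 K2 : choiceType) (op : K1 -> K2 -> K1) e a :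
  right_id e op -> conv op a << e >> = a.
Proof.
move=> op1; rewrite {1}[a]monalgE conv_suml /= [RHS]monalgE.
by apply: eq_bigr => x _; rewrite convUU op1 mulr1.
Qed.

Lemma convA (K1 K2 : choiceType) (mul : K1 -> K1 -> K1) (op : K1 -> K2 -> K2)
    a b c :
  (forall g h x, op g (op h x) = op (mul g h) x) ->
  conv op a (conv op b c) = conv op (conv mul a b) c.
Proof.
move=> opA; rewrite [a]monalgE !conv_suml; apply: eq_bigr => g _.
rewrite [b]monalgE conv_suml !conv_sumr conv_suml; apply: eq_bigr => h _.
rewrite [c]monalgE !conv_sumr; apply: eq_bigr => x _.
by rewrite !convUU opA mulrA.
Qed.

Definition group_ring (Γ : groupType) : Type := {malg int[Γ]}.

Section GroupRing.
Variable Γ : groupType.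
Local Notation ZΓ := (group_ring Γ).

HB.instance Definition _ := GRing.Zmodule.on ZΓ.

Definition gr_mul : ZΓ -> ZΓ -> ZΓ := conv (fun g h : Γ => (g * h)%g).

Fact gr_mulA : associative gr_mul.
Proof. by move=> a b c; apply: convA; exact: mulgA. Qed.

Fact gr_mul1r : left_id (<< 1%g >> : ZΓ) gr_mul.
Proof. by move=> a; apply/conv1l/mul1g. Qed.

Fact gr_mulr1 : right_id (<< 1%g >> : ZΓ) gr_mul.
Proof. by move=> a; apply/conv1r/mulg1. Qed.

Fact gr_mulDl : left_distributive gr_mul +%R.
Proof. by move=> a b c; exact: convDl. Qed.

Fact gr_mulDr : right_distributive gr_mul +%R.
Proof. by move=> a b c; exact: raddfD. Qed.

Fact gr_oner_neq0 : (<< 1%g >> : ZΓ) != 0.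
Proof. by rewrite monalgU_eq0. Qed.

HB.instance Definition _ := GRing.Zmodule_isNzRing.Build ZΓ
  gr_mulA gr_mul1r gr_mulr1 gr_mulDl gr_mulDr gr_oner_neq0.

Definition gr_of (g : Γ) : ZΓ := << g >>.

End GroupRing.

(* [Z^+[Γ]] for [K := Γ] and [Z^+[Γ/Δ]] for [K := lcosets Δ]. *)
Definition nneg (K : choiceType) : set {malg int[K]} :=
  [set a | forall x, 0 <= a@_x].

Definition normal_subgroup (Γ : groupType) (Δ : set Γ) : Prop :=
  [/\ Δ 1%g,
      forall x y, Δ x -> Δ y -> Δ (x * y)%g,
      forall x, Δ x -> Δ (x^-1)%g &
      forall g x, Δ x -> Δ (g * x * g^-1)%g].

(* The permutation module makes sense for an arbitrary subset [Δ]: [Γ] acts on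
   its left translates. *)
Section PermutationModule.
Variables (Γ : groupType) (Δ : set Γ).
Local Notation ZΓ := (group_ring Γ).

Definition lcosets : set (set Γ) :=
  range (fun g : Γ => [set (g * x)%g | x in Δ]).

Fact lcosets_base : Δ \in lcosets.
Proof.
apply: mem_set; exists 1%g => //; rewrite predeqE => x; split=> [[y Dy <-]|Dx].
  by rewrite mul1g.
by exists x; rewrite ?mul1g.
Qed.

Fact lcosets_act (g : Γ) (C : lcosets) :
  [set (g * x)%g | x in val C] \in lcosets.
Proof.
case: C => _ /= /set_mem[h _ <-]; apply: mem_set; exists (g * h)%g => //.
rewrite predeqE => x; split=> [[y Dy <-]|[_ [y Dy <-] <-]].
  by exists (h * y)%g; [exists y | rewrite mulgA].
by exists y; rewrite // mulgA.
Qed.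

Definition lcoset_base : lcosets := exist _ Δ lcosets_base.

Definition lcoset_act (g : Γ) (C : lcosets) : lcosets :=
  exist _ [set (g * x)%g | x in val C] (lcosets_act g C).

Fact lcoset_act1 : left_id 1%g lcoset_act.
Proof.
move=> C; apply: val_inj => /=; rewrite predeqE => x.
by split=> [[y Cy <-]|Cx]; [rewrite mul1g | exists x; rewrite ?mul1g].
Qed.

Fact lcoset_actM g h C :
  lcoset_act g (lcoset_act h C) = lcoset_act (g * h)%g C.
Proof.
apply: val_inj => /=; rewrite predeqE => x; split.
  by move=> [_ [y Cy <-] <-]; exists y; rewrite // mulgA.
by move=> [y Cy <-]; exists (h * y)%g; [exists y | rewrite mulgA].
Qed.

Definition perm_module : Type := {malg int[lcosets]}.

HB.instance Definition _ := GRing.Zmodule.on perm_module.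

Definition perm_scale : ZΓ -> perm_module -> perm_module := conv lcoset_act.

Fact perm_scaleA a b v :
  perm_scale a (perm_scale b v) = perm_scale (a * b) v.
Proof. by apply: convA => // g h C; exact: lcoset_actM. Qed.

Fact perm_scale1 : left_id 1 perm_scale.
Proof. by move=> v; apply/conv1l/lcoset_act1. Qed.

Fact perm_scaleDr : right_distributive perm_scale +%R.
Proof. by move=> a v w; exact: raddfD. Qed.

Fact perm_scaleDl v : {morph perm_scale^~ v : a b / a + b}.
Proof. by move=> a b; exact: convDl. Qed.

HB.instance Definition _ := GRing.Zmodule_isLmodule.Build ZΓ perm_module
  perm_scaleA perm_scale1 perm_scaleDr perm_scaleDl.

Definition perm_base : perm_module := << lcoset_base >>.

Definition perm_le (v w : perm_module) : bool := `[< nneg (w - v) >].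

Fact perm_le_refl : reflexive perm_le.
Proof. by move=> v; apply/asboolP => C; rewrite subrr mcoeff0. Qed.

Fact perm_le_anti : antisymmetric perm_le.
Proof.
move=> v w /andP[/asboolP le_vw /asboolP le_wv]; apply/malgP => C.
move: (le_vw C) (le_wv C); rewrite !mcoeffB !subr_ge0 => le1 le2.
by apply: le_anti; rewrite le1.
Qed.

Fact perm_le_trans : transitive perm_le.
Proof.
move=> w v z /asboolP le_vw /asboolP le_wz; apply/asboolP => C.
have := addr_ge0 (le_wz C) (le_vw C).
by rewrite !mcoeffB addrA subrK.
Qed.

HB.instance Definition _ := Order.Le_isPOrder.Build ring_display perm_module
  perm_le_refl perm_le_anti perm_le_trans.

(* The left module map [Z[Γ] -> Z[Γ/Δ]] sending 1 to the coset [Δ]; see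
   [perm_proj_linear] and [perm_proj1]. *)
Definition perm_proj (a : ZΓ) : perm_module := a *: perm_base.

End PermutationModule.

HB.mixin Record Lmodule_isOrderedGroup (Γ : groupType) (G : Type)
    of GRing.Lmodule (group_ring Γ) G & Order.POrder ring_display G := {
  og_leD : forall h x y : G, x <= y -> x + h <= y + h;
  og_leZ : forall (g : Γ) (x y : G), x <= y -> gr_of g *: x <= gr_of g *: y
}.

(* A left Z[Γ]-module with a translation-invariant partial order preserved by
   the group elements; it need not be directed. *)
#[short(type="orderedGroupType")]
HB.structure Definition OrderedGroup (Γ : groupType) :=
  { G of GRing.Lmodule (group_ring Γ) G & Order.POrder ring_display G
       & Lmodule_isOrderedGroup Γ G }.

Section PermutationOrder.
Variables (Γ : groupType) (Δ : set Γ).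
Local Notation M := (perm_module Δ).

Lemma perm_ge0 (v : M) : (0 <= v) = `[< nneg v >].
Proof. by rewrite -[in RHS](subr0 v). Qed.

Fact perm_leD (h v w : M) : v <= w -> v + h <= w + h.
Proof.
by move=> /asboolP le_vw; apply/asboolP; rewrite opprD addrACA subrr addr0.
Qed.

Fact perm_leZ (g : Γ) (v w : M) : v <= w -> gr_of g *: v <= gr_of g *: w.
Proof.
move=> /asboolP le_vw; apply/asboolP => C; rewrite -scalerBr.
rewrite [_ *: _](@convEw _ _ _ _ [fset g]%fset (msupp (w - v)))
  ?msuppU_le ?fsubset_refl //.
rewrite big_seq_fset1 raddf_sum; apply: sumr_ge0 => B _ /=.
by rewrite mcoeffU mcoeffUU mul1r mulrn_wge0 // le_vw.
Qed.

HB.instance Definition _ :=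
  Lmodule_isOrderedGroup.Build Γ M perm_leD perm_leZ.

End PermutationOrder.

Lemma perm_proj_linear (Γ : groupType) (Δ : set Γ) (a b c : group_ring Γ) :
  perm_proj Δ (a * b + c) = a *: perm_proj Δ b + perm_proj Δ c.
Proof. by rewrite /perm_proj scalerDl scalerA. Qed.

Lemma perm_proj1 (Γ : groupType) (Δ : set Γ) : perm_proj Δ 1 = perm_base Δ.
Proof. exact: scale1r. Qed.

Definition Stab (Γ : groupType) (G : lmodType (group_ring Γ)) (A : set G) :
  set Γ := [set g | forall x, A x -> gr_of g *: x = x].

Section OrderedGroups.
Variable Γ : groupType.
Local Notation ZΓ := (group_ring Γ).

Definition pos_cone (G : orderedGroupType Γ) : set G := [set x | 0 <= x].

Arguments pos_cone : clear implicits.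

Definition upwards_directed (G : orderedGroupType Γ) (A : set G) : Prop :=
  forall x y, A x -> A y -> exists z, [/\ A z, x <= z & y <= z].

Definition directed (G : orderedGroupType Γ) : Prop :=
  upwards_directed [set: G].

Definition order_unit (G : orderedGroupType Γ) (u : G) : Prop :=
  pos_cone G u /\
  forall x : G, exists a : ZΓ, [/\ a != 0, nneg a & x <= a *: u].

Definition generating_interval (G : orderedGroupType Γ) (D : set G) : Prop :=
  [/\ D `<=` pos_cone G,
      D 0,
      upwards_directed D,
      forall x y z, D x -> D y -> x <= z -> z <= y -> D z &
      forall x, pos_cone G x ->
        exists n (a : 'I_n -> ZΓ) (d : 'I_n -> G),
          [/\ forall i, nneg (a i), forall i, D (d i) &
              x = \sum_i a i *: d i]].

(* The objects and morphisms of [OG^D_Γ]. *)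
Record ogd := OGD {
  ogd_group :> orderedGroupType Γ;
  ogd_interval : set ogd_group;
  ogd_intervalP : generating_interval ogd_interval
}.

Arguments ogd_interval : clear implicits.

Record ogd_hom (A B : ogd) := OGDHom {
  ogd_map :> {linear A -> B};
  ogd_map_pos : ogd_map @` pos_cone A `<=` pos_cone B;
  ogd_map_interval : ogd_map @` ogd_interval A `<=` ogd_interval B
}.

Definition directed_set (d : Order.disp_t) (I : preorderType d) : Prop :=
  (exists i : I, True) /\
  forall i j : I, exists k : I, (i <= k)%O /\ (j <= k)%O.

(* [sys_map_id] and [sys_map_comp] quantify over all proofs of the order
   relations, which are booleans and hence proof irrelevant. *)
Record inductive_system (d : Order.disp_t) (I : preorderType d) :=
  InductiveSystem {
  sys_obj :> I -> ogd;
  sys_map : forall i j : I, (i <= j)%O -> ogd_hom (sys_obj i) (sys_obj j);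
  sys_map_id : forall (i : I) (ii : (i <= i)%O), sys_map ii =1 id;
  sys_map_comp : forall (i j k : I)
    (ij : (i <= j)%O) (jk : (j <= k)%O) (ik : (i <= k)%O),
    sys_map ik =1 sys_map jk \o sys_map ij
}.

Definition cocone (d : Order.disp_t) (I : preorderType d)
    (S : inductive_system I) (L : ogd) (c : forall i, ogd_hom (S i) L) : Prop :=
  forall (i j : I) (ij : (i <= j)%O), c j \o sys_map S ij =1 c i.

(* A colimit in [OG^D_Γ]: the universal property ranges over all pairs [M], and
   morphisms are compared pointwise. *)
Definition is_direct_limit (d : Order.disp_t) (I : preorderType d)
    (S : inductive_system I) (L : ogd) : Prop :=
  exists2 c : forall i, ogd_hom (S i) L, cocone c &
    forall (M : ogd) (e : forall i, ogd_hom (S i) M), cocone e ->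
      exists2 h : ogd_hom L M,
        (forall i, h \o c i =1 e i) &
        forall h' : ogd_hom L M, (forall i, h' \o c i =1 e i) -> h' =1 h.

Definition simplicial_basis (Δ : set Γ) (G : lmodType ZΓ) (n : nat)
    (x : 'I_n -> G) : Prop :=
  [/\ injective x,
      forall i, Stab [set x i] = Δ &
      forall a b : 'I_n -> ZΓ,
        (forall i, nneg (perm_proj Δ (a i))) ->
        (forall i, nneg (perm_proj Δ (b i))) ->
        (\sum_i a i *: x i = \sum_i b i *: x i <->
         forall i, perm_proj Δ (a i - b i) = 0)].

Definition simplicial_cone (Δ : set Γ) (G : lmodType ZΓ) (n : nat)
    (x : 'I_n -> G) : set G :=
  [set g | exists2 a : 'I_n -> ZΓ,
     forall i, nneg (perm_proj Δ (a i)) & g = \sum_i a i *: x i].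

(* The zero group is also the case [n = 0] of the second disjunct. *)
Definition simplicial_group (Δ : set Γ) (G : orderedGroupType Γ) : Prop :=
  (forall g : G, g = 0) \/
  exists n (x : 'I_n -> G),
    [/\ simplicial_basis Δ x, pos_cone G = simplicial_cone Δ x & directed G].

(* (SDP_Δ) is a property of directed groups, so directedness is part of it. *)
Definition SDP (Δ : set Γ) (H : orderedGroupType Γ) : Prop :=
  directed H /\
  forall n (a : 'I_n -> ZΓ) (x : 'I_n -> H),
    (forall i, pos_cone H (x i)) -> \sum_i a i *: x i = 0 ->
    exists m (b : 'I_n -> 'I_m -> ZΓ) (y : 'I_m -> H),
      [/\ (0 < m)%N,
          forall i j, nneg (b i j),
          forall j, pos_cone H (y j),
          forall i, x i = \sum_j b i j *: y j &
          forall j, \sum_i perm_proj Δ (a i * b i j) = 0].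

(* [(H, u)] is an extension of [(G, D)] by [(K, v)]. *)
Definition og_extension (G : orderedGroupType Γ) (D : set G)
    (H : orderedGroupType Γ) (u : H) (K : orderedGroupType Γ) (v : K) : Prop :=
  [/\ generating_interval D, order_unit u, order_unit v &
   exists (i : {linear G -> H}) (p : {linear H -> K}),
    [/\ {homo i : x y / x <= y}, {homo p : x y / x <= y},
        injective i & range p = [set: K]] /\
    [/\ range i = p @^-1` [set 0],
        i @^-1` pos_cone H = pos_cone G,
        p @` pos_cone H = pos_cone K,
        p u = v &
        i @^-1` [set x | 0 <= x <= u] = D]].

End OrderedGroups.

Arguments pos_cone {Γ} G.
Arguments ogd_interval {Γ} o.

(* Main.v *)
Require Import Defs.
From HB Require Import structures.
From mathcomp Require Import all_boot all_order all_algebra.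
From mathcomp Require Import generic_quotient.
From mathcomp Require Import finmap monalg.
From mathcomp Require Import boolp classical_sets.

(** The group [H] is the direct sum of [G] and [Z[Γ/Δ]], with [u = (0, Δ)].
    The interval [D] plays the part of an increasing net of approximations to
    [u] from below, so [(-d, Δ)] has to be positive for every [d] in [D].  The
    cone is the one that [G^+] and these elements generate: [(x, w)] is
    positive when [w] lifts to some nonnegative [c] of [Z[Γ]] with
    [0 <= x + c d] for some [d] in [D] ([unitization_cone]).  It is closed under
    sums because [D] is upwards directed.  It is proper, and [H] extends
    [(G, D)], because [c d] depends only on the image [π(c)] of [c] in
    [Z[Γ/Δ]], as [Δ] acts trivially on [G] ([perm_proj_ker]).

    To decompose a relation [Σ a_i (x_i, w_i) = 0] between positive elements of
    [H], choose one [d] in [D] and nonnegative lifts [c_i] of the [w_i] such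
    that all [z_i = x_i + c_i d] are positive.  Since [Σ a_i w_i = 0], the
    element [Σ a_i c_i] kills [d], whence [Σ a_i z_i = 0] in [G].
    If the [z_i] decompose along [y_1, ..., y_m], then the
    [(x_i, w_i) = (z_i, 0) + c_i (-d, Δ)] decompose along the [(y_j, 0)] and
    [(-d, Δ)] ([unitization_SDP]).

    What remains is that [G] has the decomposition property and is fixed by [Δ].
    For a simplicial group both follow from its basis.  They pass to the limit
    because every element of [G], every positive element and every relation
    already occurs at some stage of the system.  The universal property gives
    this by comparison with a concrete colimit of germs
    ([direct_limit_stages]). *)

Set Implicit Arguments.
Unset Strict Implicit.
Unset Printing Implicit Defensive.

Import Order.TTheory GRing.Theory Num.Theory.

Local Open Scope classical_set_scope.
Local Open Scope quotient_scope.
Local Open Scope ring_scope.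

(** * Free abelian groups and their positive cones *)

Section FreeAbelianGroup.
Variable K : choiceType.
Implicit Types (a b : {malg int[K]}) (P : {malg int[K]} -> Prop).

(** Nonnegative integer coefficients are sums of ones, so basis elements generate
    the cone as an additive monoid. *)
Lemma nneg_ind P :
  P 0 -> (forall a b, P a -> P b -> P (a + b)) -> (forall x, P << x >>) ->
  forall a, nneg a -> P a.
Proof.
move=> P0 PD P1 a a_ge0; rewrite [a]monalgE.
apply: (big_ind P) => // x _; have [n _ ->] : exists2 n : nat, True & a@_x = n.
  by exists `|a@_x|%N; rewrite // gez0_abs ?a_ge0.
rewrite -[Posz n]natz monalgUMn.
by elim: n => [|n IHn]; rewrite ?mulr0n ?mulrS //; apply: PD.
Qed.

Lemma nneg_decomp a : exists b c, [/\ nneg b, nneg c & a = b - c].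
Proof.
exists (\sum_(x <- msupp a) << Num.max 0 a@_x *g x >>),
       (\sum_(x <- msupp a) << Num.max 0 (- a@_x) *g x >>); split=> [y|y|].
- rewrite raddf_sum; apply: sumr_ge0 => x _ /=.
  by rewrite mcoeffU mulrn_wge0 // le_max lexx.
- rewrite raddf_sum; apply: sumr_ge0 => x _ /=.
  by rewrite mcoeffU mulrn_wge0 // le_max lexx.
rewrite {1}[a]monalgE -sumrB; apply: eq_bigr => x _.
rewrite -monalgUB; congr << _ *g _ >>.
have [x_ge0|x_lt0] := leP 0 a@_x; first by rewrite max_l ?subr0 // oppr_le0.
by rewrite max_r ?sub0r ?opprK // oppr_ge0 ltW.
Qed.

Lemma malg_ind P :
  P 0 -> (forall a b, P a -> P b -> P (a - b)) -> (forall x, P << x >>) ->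
  forall a, P a.
Proof.
move=> P0 PB P1 a; have [b [c [b_ge0 c_ge0 ->]]] := nneg_decomp a.
have PD b1 b2 : P b1 -> P b2 -> P (b1 + b2).
  by move=> Pb1 Pb2; rewrite -[b2]opprK -[- b2]sub0r; exact: PB (PB _ _ P0 Pb2).
by apply: PB; [move: b b_ge0 | move: c c_ge0]; apply: nneg_ind.
Qed.

Lemma nnegD a b : nneg a -> nneg b -> nneg (a + b).
Proof. by move=> a_ge0 b_ge0 x; rewrite mcoeffD addr_ge0 ?a_ge0 ?b_ge0. Qed.

Lemma nneg0 : nneg (0 : {malg int[K]}).
Proof. by move=> x; rewrite mcoeff0. Qed.

Lemma nnegU x : nneg (<< x >> : {malg int[K]}).
Proof. by move=> y; rewrite mcoeffU mulrn_wge0. Qed.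

Lemma nneg_sum (J : Type) (r : seq J) (F : J -> {malg int[K]}) :
  (forall j, nneg (F j)) -> nneg (\sum_(j <- r) F j).
Proof. by move=> F_ge0; apply: big_ind => //; [exact: nneg0|exact: nnegD]. Qed.

End FreeAbelianGroup.

(** * The projection onto the permutation module *)

Section PermutationProjection.
Variables (Γ : groupType) (Δ : set Γ).
Local Notation ZΓ := (group_ring Γ).
Local Notation M := (perm_module Δ).

(** The same principles for [Z[Γ]] and [Z[Γ/Δ]], phrased with the operations of
    these modules in place of those of the underlying free abelian groups. *)
Lemma gr_nneg_ind (P : ZΓ -> Prop) :
  P 0 -> (forall a b, P a -> P b -> P (a + b)) -> (forall g, P (gr_of g)) ->
  forall a, nneg a -> P a.
Proof. exact: nneg_ind. Qed.

Lemma gr_ind (P : ZΓ -> Prop) :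
  P 0 -> (forall a b, P a -> P b -> P (a - b)) -> (forall g, P (gr_of g)) ->
  forall a, P a.
Proof. exact: malg_ind. Qed.

Lemma perm_nneg_ind (P : M -> Prop) :
  P 0 -> (forall v w, P v -> P w -> P (v + w)) -> (forall C, P << C >>) ->
  forall v, nneg v -> P v.
Proof. exact: nneg_ind. Qed.

Lemma perm_ind (P : M -> Prop) :
  P 0 -> (forall v w, P v -> P w -> P (v - w)) -> (forall C, P << C >>) ->
  forall v, P v.
Proof. exact: malg_ind. Qed.

Lemma gr_nneg_decomp (a : ZΓ) :
  exists b c : ZΓ, [/\ nneg b, nneg c & a = b - c].
Proof. exact: nneg_decomp. Qed.

Fact perm_proj_zmod : zmod_morphism (perm_proj Δ).
Proof. by move=> a b; rewrite /perm_proj scalerBl. Qed.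

HB.instance Definition _ :=
  GRing.isZmodMorphism.Build ZΓ M (perm_proj Δ) perm_proj_zmod.

Lemma perm_projM a b : perm_proj Δ (a * b) = a *: perm_proj Δ b.
Proof. by rewrite /perm_proj scalerA. Qed.

Lemma perm_proj_gr g :
  perm_proj Δ (gr_of g) = << lcoset_act g (lcoset_base Δ) >>.
Proof. by rewrite [LHS]convUU mulr1. Qed.

Lemma nneg_perm_proj a : nneg a -> nneg (perm_proj Δ a).
Proof.
move: a; apply: gr_nneg_ind => [|a b pa pb|g].
- by rewrite (raddf0 (perm_proj Δ)); exact: nneg0.
- by rewrite (raddfD (perm_proj Δ)); exact: (nnegD pa pb).
- by rewrite perm_proj_gr; exact: nnegU.
Qed.

Fact coset_repP (C : lcosets Δ) :
  exists g, val C = [set (g * x)%g | x in Δ].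
Proof. by case: C => C /= /set_mem[g _ <-]; exists g. Qed.

Definition coset_rep (C : lcosets Δ) : Γ := projT1 (cid (coset_repP C)).

Lemma coset_repE C : lcoset_act (coset_rep C) (lcoset_base Δ) = C.
Proof. by apply: val_inj; rewrite /coset_rep; case: cid => g /= ->. Qed.

(** The additive map sending each coset to its chosen representative; the
    dummy second argument of [conv] makes additivity a case of [conv_zmod_l]. *)
Definition coset_lift (w : M) : ZΓ :=
  conv (fun C (_ : unit) => coset_rep C) w << tt >>.

Fact coset_lift_zmod : zmod_morphism coset_lift.
Proof. by move=> v w; exact: conv_zmod_l. Qed.

HB.instance Definition _ :=
  GRing.isZmodMorphism.Build M ZΓ coset_lift coset_lift_zmod.

Lemma coset_liftU C : coset_lift << C >> = gr_of (coset_rep C).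
Proof. by rewrite [LHS]convUU mulr1. Qed.

Lemma coset_liftK w : perm_proj Δ (coset_lift w) = w.
Proof.
move: w; apply: perm_ind => [|v w IHv IHw|C].
- by rewrite (raddf0 coset_lift) (raddf0 (perm_proj Δ)).
- by rewrite (raddfB coset_lift) (raddfB (perm_proj Δ)) /= IHv IHw.
- by rewrite coset_liftU perm_proj_gr coset_repE.
Qed.

Lemma nneg_coset_lift w : nneg w -> nneg (coset_lift w).
Proof.
move: w; apply: perm_nneg_ind => [|v w IHv IHw|C].
- by rewrite (raddf0 coset_lift); exact: nneg0.
- by rewrite (raddfD coset_lift); exact: (nnegD IHv IHw).
- by rewrite coset_liftU; exact: nnegU.
Qed.

Lemma gr_ofM (g h : Γ) : gr_of (g * h)%g = gr_of g * gr_of h.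
Proof. by rewrite [RHS]convUU mulr1. Qed.

Lemma nneg_add1_neq0 (a : ZΓ) : nneg a -> a + 1 != 0.
Proof.
move=> a0; apply/eqP => /(congr1 (fun b : ZΓ => b@_1%g)).
rewrite mcoeffD mcoeffUU mcoeff0 => /eqP; rewrite gt_eqF //.
by apply: ltr_wpDl => //; exact: a0.
Qed.

Lemma nneg_mulgr (g : Γ) (a : ZΓ) : nneg a -> nneg (gr_of g * a).
Proof.
move: a; apply: gr_nneg_ind => [|a b IHa IHb|h].
- by rewrite mulr0; exact: nneg0.
- by rewrite mulrDr; exact: (nnegD IHa IHb).
- by rewrite -gr_ofM; exact: nnegU.
Qed.

(** Elements of one left coset of [Δ] move [x] to the same place, so [a x] can be
    computed from representatives of cosets, that is, from [perm_proj Δ a]. *)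
Lemma perm_proj_ker (G : lmodType ZΓ) (A : set G) (x : G) (a : ZΓ) :
  Δ 1%g -> Δ `<=` Stab A -> A x -> perm_proj Δ a = 0 -> a *: x = 0.
Proof.
move=> Δ1 stabA Ax pa0; suff -> : a *: x = coset_lift (perm_proj Δ a) *: x.
  by rewrite pa0 (raddf0 coset_lift) scale0r.
move: a {pa0}; apply: gr_ind => [|a b IHa IHb|g].
- by rewrite (raddf0 (perm_proj Δ)) (raddf0 coset_lift).
- by rewrite (raddfB (perm_proj Δ)) (raddfB coset_lift) !scalerBl IHa IHb.
rewrite perm_proj_gr coset_liftU.
set C := lcoset_act g _; have := congr1 val (coset_repE C) => /=.
rewrite predeqE => /(_ g)[_ []]; first by exists 1%g; rewrite ?mulg1.
by move=> h Δh <-; rewrite gr_ofM -scalerA (stabA h).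
Qed.

(** Normality gives [δ g Δ = g (g^-1 δ g) Δ = g Δ]. *)
Lemma perm_module_stab : normal_subgroup Δ -> Δ `<=` Stab [set: M].
Proof.
case=> Δ1 ΔM ΔV ΔJ δ Δδ w _; move: w; apply: perm_ind => [|v w IHv IHw|C].
- by rewrite scaler0.
- by rewrite scalerBr IHv IHw.
rewrite [LHS]convUU mulr1 -[in LHS](coset_repE C) -[in RHS](coset_repE C).
rewrite lcoset_actM; set g := coset_rep C; congr << _ *g _ >>.
apply: val_inj; rewrite /= predeqE => x; split=> [[y Δy <-]|[y Δy <-]].
  exists (g^-1 * δ * g * y)%g; last by rewrite !mulgA mulgV mul1g.
  by apply: ΔM => //; rewrite -{2}[g]invgK; exact: ΔJ.
exists (g^-1 * δ^-1 * g * y)%g; last by rewrite !mulgA mulgK mulgV mul1g.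
by apply: ΔM => //; rewrite -{2}[g]invgK; apply: ΔJ; exact: ΔV.
Qed.

End PermutationProjection.

(** * Inequalities in ordered groups *)

Section OrderedGroupTheory.
Variables (Γ : groupType) (G : orderedGroupType Γ).
Implicit Types x y z : G.

Lemma og_leD2r z x y : (x + z <= y + z) = (x <= y).
Proof.
apply/idP/idP; last exact: og_leD.
by move/(og_leD (- z)); rewrite !addrK.
Qed.

Lemma og_subr_ge0 x y : (0 <= y - x) = (x <= y).
Proof. by rewrite -[LHS](og_leD2r x) add0r subrK. Qed.

Lemma og_leD2 x y z t : x <= y -> z <= t -> x + z <= y + t.
Proof.
move=> le_xy le_zt; apply: le_trans (_ : y + z <= _); first exact: og_leD.
by rewrite ![y + _]addrC; exact: og_leD.
Qed.

Lemma og_addr_ge0 x y : 0 <= x -> 0 <= y -> 0 <= x + y.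
Proof. by move=> x0 y0; rewrite -[0]addr0; exact: og_leD2. Qed.

Lemma og_scale_ge0 (a : group_ring Γ) x : nneg a -> 0 <= x -> 0 <= a *: x.
Proof.
move=> + x_ge0; move: a; apply: gr_nneg_ind => [|a b|g]; first by rewrite scale0r.
  by rewrite scalerDl; exact: og_addr_ge0.
by rewrite -[0](scaler0 _ (gr_of g)); exact: og_leZ.
Qed.

Lemma og_scale_le (a : group_ring Γ) x y : nneg a -> x <= y -> a *: x <= a *: y.
Proof.
by move=> a_ge0; rewrite -[x <= y]og_subr_ge0 -[_ *: x <= _]og_subr_ge0 -scalerBr;
  exact: og_scale_ge0.
Qed.

Lemma og_sum_ge0 (J : Type) (r : seq J) (F : J -> G) :
  (forall j, 0 <= F j) -> 0 <= \sum_(j <- r) F j.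
Proof.
move=> F_ge0; apply: (big_ind (fun y => 0 <= y)) => //; exact: og_addr_ge0.
Qed.

End OrderedGroupTheory.

(** * The unitization of an ordered group with a generating interval *)

(** The hypotheses are parameters of the type because the relation declared on it
    below is an order only under them. *)
Definition unitization (Γ : groupType) (Δ : set Γ) (G : orderedGroupType Γ)
  (D : set G) (hD : generating_interval D) (Δ1 : Δ 1%g)
  (hG : Δ `<=` Stab [set: G]) : Type := (G * perm_module Δ)%type.

Section Unitization.
Variables (Γ : groupType) (Δ : set Γ) (G : orderedGroupType Γ) (D : set G).
Hypotheses (hD : generating_interval D) (Δ1 : Δ 1%g).
Hypothesis hG : Δ `<=` Stab [set: G].
Local Notation ZΓ := (group_ring Γ).
Local Notation M := (perm_module Δ).
Local Notation H := (unitization hD Δ1 hG).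

HB.instance Definition _ := GRing.Lmodule.copy H (G * M)%type.

(** The sums of an element of [G^+] and [c (-d, Δ)], for [c] in [Z^+[Γ]] and [d]
    in [D]. *)
Definition unitization_cone : set H :=
  [set h | exists (c : ZΓ) (d : G),
    [/\ nneg c, perm_proj Δ c = h.2, D d & 0 <= h.1 + c *: d]].

Definition unitization_le (h k : H) : bool :=
  `[< unitization_cone (k - h) >].

Let hD_ge0 d : D d -> 0 <= d.
Proof. by case: hD => sub _ _ _ _; exact: sub. Qed.

(** A common upper bound [e] in [D] of the two witnesses serves for the sum,
    because [c d <= c e] for nonnegative [c]. *)
Lemma unitization_coneD h k :
  unitization_cone h -> unitization_cone k -> unitization_cone (h + k).
Proof.
case: hD => _ _ dirD _ _ [c [d [c0 ch Dd hd]]] [c' [d' [c'0 c'k Dd' kd']]].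
have [e [De de d'e]] := dirD d d' Dd Dd'.
exists (c + c'), e; split=> //; first exact: nnegD.
  by rewrite raddfD /= ch c'k.
rewrite scalerDl addrACA; apply: og_addr_ge0.
  by apply: le_trans hd _; apply: og_leD2 => //; exact: og_scale_le.
by apply: le_trans kd' _; apply: og_leD2 => //; exact: og_scale_le.
Qed.

Fact unitization_le_refl : reflexive unitization_le.
Proof.
move=> h; apply/asboolP; rewrite subrr; exists 0, 0.
case: hD => _ D0 _ _ _; split=> //; first exact: nneg0.
  by rewrite raddf0.
by rewrite scaler0 addr0.
Qed.

(** If [(x, w)] and its opposite lie in the cone, then [w = 0] in [Z[Γ/Δ]]; the
    lift [c] of [w] therefore kills [d], and [x] and [-x] are both positive. *)
Fact unitization_le_anti : antisymmetric unitization_le.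
Proof.
move=> h k /andP[/asboolP le_hk /asboolP le_kh].
have ge0 (l : H) : unitization_cone l -> 0 <= l.2 /\ (l.2 = 0 -> 0 <= l.1).
  move=> [c [d [c0 cl _ ld]]]; split.
    by rewrite perm_ge0 -cl; apply/asboolP/nneg_perm_proj.
  move=> l0; rewrite (_ : l.1 = l.1 + c *: d) //.
  by rewrite (perm_proj_ker Δ1 hG (x := d)) ?addr0 // cl.
case: (ge0 _ le_hk) (ge0 _ le_kh) => hk2 hk1 [kh2 kh1].
have e2 : h.2 = k.2.
  apply/le_anti.
  by rewrite -[h.2 <= _]og_subr_ge0 -[k.2 <= _]og_subr_ge0 hk2 kh2.
have e1 : h.1 = k.1.
  apply/le_anti; rewrite -[h.1 <= _]og_subr_ge0 -[k.1 <= _]og_subr_ge0.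
  by rewrite hk1 ?kh1 //= e2 subrr.
by case: (h) (k) e1 e2 => ? ? [? ?] /= -> ->.
Qed.

Fact unitization_le_trans : transitive unitization_le.
Proof.
move=> k h l /asboolP le_hk /asboolP le_kl; apply/asboolP.
by rewrite -[l - h](subrKA k); exact: unitization_coneD.
Qed.

HB.instance Definition _ := Order.Le_isPOrder.Build ring_display H
  unitization_le_refl unitization_le_anti unitization_le_trans.

Fact unitization_leD (l h k : H) : h <= k -> h + l <= k + l.
Proof.
move=> le_hk; rewrite [_ <= _]/(unitization_le _ _) /unitization_le.
by rewrite opprD addrACA subrr addr0.
Qed.

Fact unitization_leZ g (h k : H) : h <= k -> gr_of g *: h <= gr_of g *: k.
Proof.
move=> /asboolP[c [d [c0 ce Dd le_d]]]; apply/asboolP; rewrite -scalerBr.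
exists (gr_of g * c), d; split=> [||//|].
- exact: nneg_mulgr.
- by rewrite perm_projM ce.
- by rewrite -scalerA -scalerDr; apply: og_scale_ge0 => //; exact: nnegU.
Qed.

HB.instance Definition _ :=
  Lmodule_isOrderedGroup.Build Γ H unitization_leD unitization_leZ.

Lemma unitization_ge0 (h : H) : (0 <= h) = `[< unitization_cone h >].
Proof. by rewrite [LHS]/(unitization_le _ _) /unitization_le subr0. Qed.

Definition unitization_inl (x : G) : H := (x, 0).
Definition unitization_fst (h : H) : G := h.1.
Definition unitization_snd (h : H) : M := h.2.
Definition unitization_one : H := (0, perm_base Δ).

Fact unitization_inl_linear : linear unitization_inl.
Proof.
move=> a x y; rewrite -[RHS]/(a *: x + y, a *: (0 : M) + 0).
by rewrite scaler0 addr0.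
Qed.

HB.instance Definition _ := GRing.isLinear.Build ZΓ G H *:%R
  unitization_inl unitization_inl_linear.

Fact unitization_snd_linear : linear unitization_snd.
Proof. by []. Qed.

HB.instance Definition _ := GRing.isLinear.Build ZΓ H M *:%R
  unitization_snd unitization_snd_linear.

Fact unitization_fst_linear : linear unitization_fst.
Proof. by []. Qed.

HB.instance Definition _ := GRing.isLinear.Build ZΓ H G *:%R
  unitization_fst unitization_fst_linear.

Lemma unitization_inl_ge0 (x : G) : (0 <= unitization_inl x) = (0 <= x).
Proof.
rewrite unitization_ge0; apply/asboolP/idP => [[c [d [_ c0 _ le]]]|x_ge0].
  by move: le; rewrite (perm_proj_ker Δ1 hG (x := d)) ?addr0.
case: hD => _ D0 _ _ _; exists 0, 0; split=> //; first exact: nneg0.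
  by rewrite raddf0.
by rewrite scaler0 addr0.
Qed.

Lemma interval_bound n (d : 'I_n -> G) :
  (forall i, D (d i)) -> exists2 e, D e & forall i, d i <= e.
Proof.
case: hD => _ D0 dirD _ _.
elim: n d => [|n IHn] d Dd; first by exists 0 => // [[]].
have [e De le_e] := IHn (fun i => d (lift ord0 i)) (fun i => Dd _).
have [e' [De' le1 le2]] := dirD _ _ De (Dd ord0).
exists e' => // i; case: (unliftP ord0 i) => [j|] -> //.
exact: le_trans (le_e j) le1.
Qed.

(** [G^+] is generated by [D]: in [x = Σ a_i d_i], replace all [d_i] by a common
    upper bound in [D]. *)
Lemma interval_multiple_bound (x : G) :
  0 <= x -> exists (c : ZΓ) d, [/\ nneg c, D d & x <= c *: d].
Proof.
case: hD => _ D0 dirD _ gen /gen[n [a [d [a0 Dd ->]]]].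
have [e De le_e] := interval_bound Dd.
exists (\sum_i a i), e; split=> //; first exact: nneg_sum.
rewrite -og_subr_ge0 scaler_suml -sumrB; apply: og_sum_ge0 => i.
by rewrite -scalerBr og_scale_ge0 // og_subr_ge0.
Qed.

Hypothesis hdir : forall x : G, exists2 y, 0 <= y & x <= y.

Lemma unitization_one_ge0 : 0 <= unitization_one.
Proof.
rewrite unitization_ge0; apply/asboolP; exists 1, 0; case: hD => _ D0 _ _ _.
split=> //.
- exact: nnegU.
- exact: perm_proj1.
- by rewrite scaler0 addr0.
Qed.

(** Given [(x, v1 - v2)] with [x <= s d], both coordinates are dominated by [a u]
    when [a] is the sum of a lift of [v1] and [s]; adding 1 makes [a] nonzero. *)
Lemma unitization_one_order_unit : order_unit unitization_one.
Proof.
split=> [|[x w]]; first exact: unitization_one_ge0.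
have [y y0 le_xy] := hdir x.
have [s [d [s0 Dd le_yd]]] := interval_multiple_bound y0.
have [v1 [v2 [v10 v20 ->]]] := nneg_decomp w.
have projD (v : M) :
    perm_proj Δ (coset_lift v + s + 1) = v + (perm_proj Δ s + perm_base Δ).
  by rewrite !(raddfD (perm_proj Δ)) /= coset_liftK perm_proj1 addrA.
exists (coset_lift v1 + s + 1); split.
- by apply: nneg_add1_neq0; apply: nnegD; first exact: nneg_coset_lift.
- by apply: nnegD; [apply: nnegD => //; exact: nneg_coset_lift|exact: nnegU].
(* The second coordinate of [a u - (x, w)] is [v2 + π(s + 1)]. *)
apply/asboolP; exists (coset_lift v2 + s + 1), d; split=> //=.
- by apply: nnegD; [apply: nnegD => //; exact: nneg_coset_lift|exact: nnegU].
- by rewrite projD -[RHS]/(perm_proj Δ _ - _) projD opprB [RHS]addrC subrKA.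
rewrite scaler0 add0r addrC og_subr_ge0 !scalerDl scale1r.
apply: le_trans le_xy _; apply: le_trans le_yd _.
rewrite -og_subr_ge0 addrAC addrK; apply: og_addr_ge0; last exact: hD_ge0.
by apply: og_scale_ge0; [exact: nneg_coset_lift|exact: hD_ge0].
Qed.

Lemma unitization_directed : directed H.
Proof.
have [u0 bd] := unitization_one_order_unit; move=> h k _ _.
have [a [_ a0 le_h]] := bd h; have [b [_ b0 le_k]] := bd k.
exists (a *: unitization_one + b *: unitization_one); split=> [//||].
  rewrite -[h]addr0; apply: (og_leD2 le_h).
  exact: (og_scale_ge0 b0 u0).
rewrite -[k]add0r; apply: og_leD2 le_k.
exact: (og_scale_ge0 a0 u0).
Qed.

Lemma unitization_one_sub_ge0 d : D d -> 0 <= (- d, perm_base Δ) :> H.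
Proof.
move=> Dd; rewrite unitization_ge0; apply/asboolP; exists 1, d; split=> //.
- exact: nnegU.
- exact: perm_proj1.
- by rewrite scale1r addNr.
Qed.

(** The interval condition is where [D] reappears: [(x, 0) <= u] means [x <= c d]
    with [c] in the class of 1 modulo the kernel of [perm_proj Δ], so [x <= d]. *)
Lemma unitization_og_extension : og_extension D unitization_one (perm_base Δ).
Proof.
have snd_ge0 (h : H) : 0 <= h -> 0 <= unitization_snd h.
  rewrite unitization_ge0 perm_ge0 /unitization_snd.
  move=> /asboolP[c [d [c0 <- _ _]]].
  by apply/asboolP; exact: nneg_perm_proj.
have [_ D0 _ convD _] := hD.
split=> //; first exact: unitization_one_order_unit.
  split=> [|w]; first exact: (snd_ge0 _ unitization_one_ge0).
  have [_ bd] := unitization_one_order_unit.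
  have [a [a_neq0 a0 le_w]] := bd (0, w); exists a; split=> //.
  rewrite -og_subr_ge0.
  by move: le_w; rewrite -og_subr_ge0 => le_w; exact: (snd_ge0 _ le_w).
exists unitization_inl, unitization_snd; split; split.
- move=> x y le_xy; rewrite -og_subr_ge0 -linearB.
  by rewrite unitization_inl_ge0 og_subr_ge0.
- by move=> h k le_hk; rewrite -og_subr_ge0 -linearB snd_ge0 // og_subr_ge0.
- by move=> x y [].
- by rewrite predeqE => w; split=> // _; exists (0, w).
- rewrite predeqE => -[x w]; split=> [[y _ [_ <-]] //|/= w0].
  by exists x => //; rewrite /unitization_inl -w0.
- by rewrite predeqE => x; rewrite /pos_cone /= unitization_inl_ge0.
- rewrite predeqE => w; split=> [[h h0 <-]|w0]; first exact: snd_ge0.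
  exists (0, w) => //; rewrite /pos_cone /= unitization_ge0; apply/asboolP.
  exists (coset_lift w), 0; split=> //.
  + apply: nneg_coset_lift; move: w0.
    by rewrite /pos_cone /= perm_ge0 => /asboolP.
  + exact: coset_liftK.
  + by rewrite scaler0 addr0.
- by [].
rewrite predeqE => x; split=> /= [/andP[x0]|Dx].
  rewrite -og_subr_ge0 unitization_ge0 => /asboolP[c [d [_ cE Dd]]].
  rewrite /= sub0r; have -> : c *: d = d.
    apply/eqP; rewrite -subr_eq0 -{2}[d]scale1r -scalerBl; apply/eqP.
    apply: (perm_proj_ker Δ1 hG) => //; rewrite (raddfB (perm_proj Δ)) /= cE.
    by rewrite perm_proj1 /= subr0 subrr.
  rewrite addrC og_subr_ge0 => le_xd; apply: (convD 0 d) => //.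
  by rewrite -unitization_inl_ge0.
apply/andP; split; first by rewrite unitization_inl_ge0 hD_ge0.
rewrite -og_subr_ge0 (_ : _ - _ = (- x, perm_base Δ)) ?unitization_one_sub_ge0 //.
by rewrite -[LHS]/(0 - x, perm_base Δ - 0) sub0r subr0.
Qed.

(** The second half of [SDP], except that an empty family [y] is allowed: it occurs
    for the zero group, and [unitization_SDP] always adds one more element. *)
Definition decomposition_property : Prop :=
  forall n (a : 'I_n -> ZΓ) (x : 'I_n -> G),
    (forall i, 0 <= x i) -> \sum_i a i *: x i = 0 ->
    exists m (b : 'I_n -> 'I_m -> ZΓ) (y : 'I_m -> G),
      [/\ forall i j, nneg (b i j), forall j, 0 <= y j,
          forall i, x i = \sum_j b i j *: y j &
          forall j, \sum_i perm_proj Δ (a i * b i j) = 0].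

(** The relation is moved into [G] by adding [c_i e] to the first coordinates;
    the added terms are recovered from the extra positive element [(-e, Δ)]. *)
Lemma unitization_SDP : decomposition_property -> SDP Δ H.
Proof.
move=> decG; split; first exact: unitization_directed.
move=> n a h h0 ah0.
have /choice[c /choice[d cdP]] : forall i, exists (c : ZΓ) (d : G),
    [/\ nneg c, perm_proj Δ c = (h i).2, D d & 0 <= (h i).1 + c *: d].
  by move=> i; apply/asboolP; have := h0 i; rewrite /pos_cone /= unitization_ge0.
have [e De le_e] : exists2 e, D e & forall i, d i <= e.
  by apply: interval_bound => i; case: (cdP i).
(* This is the second coordinate of the relation. *)
have ac0 : \sum_i a i *: perm_proj Δ (c i) = 0.
  rewrite -[RHS]/(unitization_snd 0) -ah0 raddf_sum; apply: eq_bigr => i _ /=.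
  by case: (cdP i) => _ ->.
have [||m [b [y [b0 y0 hE ab0]]]] := decG n a (fun i => (h i).1 + c i *: e).
- move=> i; have [c0 _ _ le0] := cdP i; apply: le_trans le0 _.
  by apply: og_leD2 => //; exact: og_scale_le.
- under eq_bigr => i _ do rewrite scalerDr scalerA.
  rewrite big_split -scaler_suml (perm_proj_ker Δ1 hG (x := e)) //= ?addr0.
    by rewrite -[RHS]/(unitization_fst 0) -ah0 raddf_sum.
  rewrite (raddf_sum (perm_proj Δ)) -[RHS]ac0; apply: eq_bigr => i _ /=.
  by rewrite perm_projM.
exists m.+1, (fun i j => if unlift ord0 j is Some k then b i k else c i),
  (fun j => if unlift ord0 j is Some k then unitization_inl (y k)
            else (- e, perm_base Δ)).
split=> [//||||].
- by move=> i j; case: unliftP => [k|] _; [exact: b0|case: (cdP i)].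
- move=> j; rewrite /pos_cone /=; case: unliftP => [k|] _.
    by rewrite unitization_inl_ge0.
  exact: unitization_one_sub_ge0.
- move=> i; rewrite big_ord_recl unlift_none.
  under eq_bigr => j _ do rewrite liftK -linearZ.
  rewrite -raddf_sum -hE.
  rewrite -[RHS]/(c i *: - e + ((h i).1 + c i *: e), perm_proj Δ (c i) + 0).
  case: (cdP i) => _ -> _ _; rewrite scalerN addrC addrK addr0.
  by case: (h i).
move=> j; case: (unliftP ord0 j) => [k|] _; first exact: ab0.
by rewrite -[RHS]ac0; apply: eq_bigr => i _; rewrite perm_projM.
Qed.

Lemma unitization_stab : normal_subgroup Δ -> Δ `<=` Stab [set: H].
Proof.
move=> nΔ δ Δδ [x w] _; rewrite -[LHS]/(gr_of δ *: x, gr_of δ *: w).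
by rewrite (hG Δδ) // (perm_module_stab nΔ Δδ).
Qed.

End Unitization.

(** * Direct limits in the category of groups with generating intervals *)

Section Colimit.
Variables (Γ : groupType) (d : Order.disp_t) (I : preorderType d).
Variables (hI : directed_set I) (S : inductive_system Γ I).
Local Notation ZΓ := (group_ring Γ).

Lemma upper_bound2 (i j : I) : exists k, (i <= k)%O /\ (j <= k)%O.
Proof. by case: hI. Qed.

Lemma upper_bound4 (i j k l : I) :
  exists m, [/\ (i <= m)%O, (j <= m)%O, (k <= m)%O & (l <= m)%O].
Proof.
have [p [ip jp]] := upper_bound2 i j; have [q [kq lq]] := upper_bound2 k l.
have [m [pm qm]] := upper_bound2 p q; exists m; split.
- exact: le_trans ip pm.
- exact: le_trans jp pm.
- exact: le_trans kq qm.
- exact: le_trans lq qm.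
Qed.

Lemma directed_set_bound n (f : 'I_n -> I) : exists k, forall i, (f i <= k)%O.
Proof.
case: (hI) => -[i0 _] _; elim: n f => [|n IHn] f; first by exists i0 => -[].
have [k fk] := IHn (fun i => f (lift ord0 i)).
have [l [kl f0l]] := upper_bound2 k (f ord0); exists l => i.
by case: (unliftP ord0 i) => [j|] -> //; exact: le_trans (fk j) kl.
Qed.

(** An element of some stage, identified below with its images at later stages. *)
Definition germ : Type := {i : I & S i}.
HB.instance Definition _ := Choice.on germ.

Definition germ_eq (s t : germ) : bool :=
  `[< exists k (sk : (tag s <= k)%O) (tk : (tag t <= k)%O),
        sys_map S sk (tagged s) = sys_map S tk (tagged t) >].

Lemma sys_mapA i j k (ij : (i <= j)%O) (jk : (j <= k)%O) (ik : (i <= k)%O) x :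
  sys_map S jk (sys_map S ij x) = sys_map S ik x.
Proof. by rewrite (sys_map_comp ij jk ik). Qed.

(** Equality at one stage persists; in this form several germs can be compared at a
    common later stage. *)
Lemma germ_eq_ge (s t : germ) : germ_eq s t ->
  exists k0, forall k (sk : (tag s <= k)%O) (tk : (tag t <= k)%O), (k0 <= k)%O ->
    sys_map S sk (tagged s) = sys_map S tk (tagged t).
Proof.
move=> /asboolP[k0 [sk0 [tk0 e0]]]; exists k0 => k sk tk kk.
by rewrite -(sys_mapA sk0 kk) e0 (sys_mapA tk0 kk tk).
Qed.

Fact germ_eq_refl : reflexive germ_eq.
Proof.
by move=> s; apply/asboolP; exists (tag s), (lexx _), (lexx _).
Qed.

Fact germ_eq_sym : symmetric germ_eq.
Proof.
by move=> s t; apply/asboolP/asboolP => -[k [sk [tk e]]]; exists k, tk, sk.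
Qed.

Fact germ_eq_trans : transitive germ_eq.
Proof.
move=> t s r /germ_eq_ge[k1 e1] /germ_eq_ge[k2 e2].
have [k3 [sk3 tk3 rk3 _]] := upper_bound4 (tag s) (tag t) (tag r) (tag r).
have [k [k3k k1k k2k _]] := upper_bound4 k3 k1 k2 k2.
have [sk tk] := (le_trans sk3 k3k, le_trans tk3 k3k).
have rk := le_trans rk3 k3k.
by apply/asboolP; exists k, sk, rk; rewrite (e1 k sk tk) ?(e2 k tk rk).
Qed.

Canonical germ_equiv := EquivRel germ_eq germ_eq_refl germ_eq_sym germ_eq_trans.

Definition colimit : Type := {eq_quot germ_equiv}.
HB.instance Definition _ := Choice.on colimit.

Definition stage i (x : S i) : colimit :=
  \pi_{eq_quot germ_equiv} (existT _ i x : germ).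

Lemma stage_eq_ge i j (x : S i) (y : S j) : stage x = stage y ->
  exists k0, forall k (ik : (i <= k)%O) (jk : (j <= k)%O), (k0 <= k)%O ->
    sys_map S ik x = sys_map S jk y.
Proof. by move/eqmodP; exact: (@germ_eq_ge (existT _ i x) (existT _ j y)). Qed.

Lemma stage_map i j (ij : (i <= j)%O) x : stage (sys_map S ij x) = stage x.
Proof.
apply/eqmodP/asboolP; exists j, (lexx j), ij.
exact: sys_map_id.
Qed.

Lemma stage_surj u : exists i (x : S i), u = stage x.
Proof.
exists (tag (repr u)), (tagged (repr u)).
by rewrite /stage -{1}[u]reprK; case: (repr u).
Qed.

Lemma stage_surj2 u v : exists i (x y : S i), u = stage x /\ v = stage y.
Proof.
have [i [x ->]] := stage_surj u; have [j [y ->]] := stage_surj v.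
have [k [ik jk]] := upper_bound2 i j.
exists k, (sys_map S ik x), (sys_map S jk y).
by rewrite !stage_map.
Qed.

Lemma stage_surj3 u v w :
  exists i (x y z : S i), [/\ u = stage x, v = stage y & w = stage z].
Proof.
have [i [x [y [-> ->]]]] := stage_surj2 u v; have [j [z ->]] := stage_surj w.
have [k [ik jk]] := upper_bound2 i j.
exists k, (sys_map S ik x), (sys_map S ik y), (sys_map S jk z).
by rewrite !stage_map.
Qed.

(** The operations are chosen from their graphs; [stageD] and [stageZ] state
    that the graphs are functional. *)
Fact colim_add_ex u v :
  exists w, exists i (x y : S i),
    [/\ u = stage x, v = stage y & w = stage (x + y)].
Proof.
have [i [x [y [-> ->]]]] := stage_surj2 u v.
by exists (stage (x + y)), i, x, y.
Qed.

Definition colim_add u v : colimit := projT1 (cid (colim_add_ex u v)).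

Fact colim_scale_ex (a : ZΓ) u :
  exists w, exists i (x : S i), u = stage x /\ w = stage (a *: x).
Proof. by have [i [x ->]] := stage_surj u; exists (stage (a *: x)), i, x. Qed.

Definition colim_scale a u : colimit := projT1 (cid (colim_scale_ex a u)).

Lemma stageD i (x y : S i) : stage (x + y) = colim_add (stage x) (stage y).
Proof.
rewrite /colim_add; case: cid => w /= [j [x' [y' [ex ey ->]]]].
have [[k1 e1] [k2 e2]] := (stage_eq_ge ex, stage_eq_ge ey).
have [k [ik jk k1k k2k]] := upper_bound4 i j k1 k2.
rewrite -(stage_map ik) -[RHS](stage_map jk) !linearD.
by rewrite (e1 k ik jk) ?(e2 k ik jk).
Qed.

Lemma stageZ i a (x : S i) : stage (a *: x) = colim_scale a (stage x).
Proof.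
rewrite /colim_scale; case: cid => w /= [j [x' [/stage_eq_ge[k1 e1] ->]]].
have [k [ik jk k1k _]] := upper_bound4 i j k1 k1.
by rewrite -(stage_map ik) -[RHS](stage_map jk) !linearZ (e1 k ik jk).
Qed.

Definition some_stage : I := projT1 (cid (proj1 hI)).
Definition colim_zero : colimit := stage (0 : S some_stage).

Lemma stage0 i : stage (0 : S i) = colim_zero.
Proof.
have [k [ik jk]] := upper_bound2 i some_stage.
by rewrite /colim_zero -(stage_map ik) -[RHS](stage_map jk) !linear0.
Qed.

Fact colim_addA : associative colim_add.
Proof.
move=> u v w; have [i [x [y [z [-> -> ->]]]]] := stage_surj3 u v w.
by rewrite -!stageD addrA.
Qed.

Fact colim_addC : commutative colim_add.
Proof.
move=> u v; have [i [x [y [-> ->]]]] := stage_surj2 u v.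
by rewrite -!stageD addrC.
Qed.

Fact colim_add0 : left_id colim_zero colim_add.
Proof.
by move=> u; have [i [x ->]] := stage_surj u; rewrite -(stage0 i) -stageD add0r.
Qed.

Fact colim_addN : left_inverse colim_zero (colim_scale (- 1)) colim_add.
Proof.
move=> u; have [i [x ->]] := stage_surj u.
by rewrite -stageZ -stageD scaleN1r addNr stage0.
Qed.

HB.instance Definition _ := GRing.isZmodule.Build colimit
  colim_addA colim_addC colim_add0 colim_addN.

Fact colim_scaleA a b u : colim_scale a (colim_scale b u) = colim_scale (a * b) u.
Proof. by have [i [x ->]] := stage_surj u; rewrite -!stageZ scalerA. Qed.

Fact colim_scale1 : left_id 1 colim_scale.
Proof. by move=> u; have [i [x ->]] := stage_surj u; rewrite -stageZ scale1r. Qed.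

Fact colim_scaleDr : right_distributive colim_scale +%R.
Proof.
move=> a u v; have [i [x [y [-> ->]]]] := stage_surj2 u v.
by rewrite -[stage x + _]stageD -!stageZ -[RHS]stageD scalerDr.
Qed.

Fact colim_scaleDl u : {morph colim_scale^~ u : a b / a + b}.
Proof.
move=> a b; have [i [x ->]] := stage_surj u.
by rewrite -!stageZ -[RHS]stageD scalerDl.
Qed.

HB.instance Definition _ := GRing.Zmodule_isLmodule.Build ZΓ colimit
  colim_scaleA colim_scale1 colim_scaleDr colim_scaleDl.

Fact stage_linear i : linear (@stage i).
Proof. by move=> a x y; rewrite stageD stageZ. Qed.
HB.instance Definition _ i :=
  GRing.isLinear.Build ZΓ (S i) colimit *:%R (@stage i) (@stage_linear i).

Lemma stage_eq0 i (x : S i) :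
  stage x = 0 -> exists j (ij : (i <= j)%O), sys_map S ij x = 0.
Proof.
rewrite -[RHS](stage0 i) => /stage_eq_ge[k0 e].
have [k [ik k0k]] := upper_bound2 i k0; exists k, ik.
by rewrite (e k ik ik) // linear0.
Qed.

Lemma sys_map_ge0 i j (ij : (i <= j)%O) x : 0 <= x -> 0 <= sys_map S ij x.
Proof. by move=> x0; apply: (@ogd_map_pos _ _ _ (sys_map S ij)); exists x. Qed.

Lemma sys_map_interval i j (ij : (i <= j)%O) x :
  ogd_interval (S i) x -> ogd_interval (S j) (sys_map S ij x).
Proof.
by move=> Dx; apply: (@ogd_map_interval _ _ _ (sys_map S ij)); exists x.
Qed.

Definition colim_le (u v : colimit) : bool :=
  `[< exists i (x : S i), 0 <= x /\ v - u = stage x >].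

Fact colim_le_refl : reflexive colim_le.
Proof.
move=> u; apply/asboolP; exists some_stage, 0.
by rewrite subrr linear0.
Qed.

(** If [x] and [y] are positive and their sum dies in the colimit, then it dies at
    a later stage, where [x] and [y] are opposite and both positive. *)
Fact colim_le_anti : antisymmetric colim_le.
Proof.
move=> u v /andP[/asboolP[i [x [x0 vuE]]] /asboolP[j [y [y0 uvE]]]].
have [k [ik jk]] := upper_bound2 i j.
have : stage (sys_map S ik x + sys_map S jk y) = 0.
  by rewrite linearD /= !stage_map -vuE -uvE addrC subrKA subrr.
move=> /stage_eq0[l [kl]]; rewrite linearD /= => e.
have xl0 : 0 <= sys_map S kl (sys_map S ik x) by do 2!apply: sys_map_ge0.
have yl0 : 0 <= sys_map S kl (sys_map S jk y) by do 2!apply: sys_map_ge0.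
have xl : sys_map S kl (sys_map S ik x) = 0.
  by apply/le_anti; rewrite xl0 andbT -og_subr_ge0 sub0r (addr0_eq e).
apply/esym/eqP; rewrite -subr_eq0 vuE -(stage_map ik) -(stage_map kl) xl.
by rewrite linear0.
Qed.

Fact colim_le_trans : transitive colim_le.
Proof.
move=> v u w /asboolP[i [x [x0 vuE]]] /asboolP[j [y [y0 uvE]]].
have [k [ik jk]] := upper_bound2 i j; apply/asboolP.
exists k, (sys_map S ik x + sys_map S jk y); split.
  by apply: og_addr_ge0; exact: sys_map_ge0.
by rewrite linearD /= !stage_map -vuE -uvE [RHS]addrC subrKA.
Qed.

HB.instance Definition _ := Order.Le_isPOrder.Build ring_display colimit
  colim_le_refl colim_le_anti colim_le_trans.

Fact colim_leD (w u v : colimit) : u <= v -> u + w <= v + w.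
Proof.
move=> /asboolP[i [x [x0 e]]]; apply/asboolP; exists i, x; split=> //.
by rewrite opprD addrACA subrr addr0.
Qed.

Fact colim_leZ g (u v : colimit) : u <= v -> gr_of g *: u <= gr_of g *: v.
Proof.
move=> /asboolP[i [x [x0 e]]]; apply/asboolP; exists i, (gr_of g *: x); split.
  by apply: og_scale_ge0 => //; exact: nnegU.
by rewrite -scalerBr e linearZ.
Qed.

HB.instance Definition _ :=
  Lmodule_isOrderedGroup.Build Γ colimit colim_leD colim_leZ.

Lemma colim_ge0P (u : colimit) :
  0 <= u <-> exists i (x : S i), 0 <= x /\ u = stage x.
Proof. by split=> [/asboolP|?]; [|apply/asboolP]; rewrite subr0. Qed.

Lemma stage_ge0 i (x : S i) : 0 <= x -> 0 <= stage x.
Proof. by move=> x0; apply/colim_ge0P; exists i, x. Qed.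

Definition colim_interval : set colimit :=
  [set u | exists i (x : S i), ogd_interval (S i) x /\ u = stage x].

(** Convexity is the point that needs an argument: if [d <= z <= d'] in the colimit,
    then [d + p + q = d'] at some stage with [p] and [q] positive and [d + p]
    representing [z], so convexity of the interval at that stage applies. *)
Fact colim_intervalP : generating_interval colim_interval.
Proof.
split.
- move=> _ [i [x [Dx ->]]]; apply: stage_ge0.
  by have [sub _ _ _ _] := ogd_intervalP (S i); exact: sub.
- exists some_stage, 0; split; last by rewrite linear0.
  by have [] := ogd_intervalP (S some_stage).
- move=> _ _ [i [x [Dx ->]]] [j [y [Dy ->]]].
  have [k [ik jk]] := upper_bound2 i j.
  have [_ _ dirD _ _] := ogd_intervalP (S k).
  have [z [Dz xz yz]] :=
    dirD _ _ (sys_map_interval ik Dx) (sys_map_interval jk Dy).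
  exists (stage z); split; first by exists k, z.
    by rewrite -(stage_map ik) -og_subr_ge0 -linearB stage_ge0 // og_subr_ge0.
  by rewrite -(stage_map jk) -og_subr_ge0 -linearB stage_ge0 // og_subr_ge0.
- move=> _ _ z [i [x [Dx ->]]] [j [y [Dy ->]]].
  rewrite -og_subr_ge0 => /colim_ge0P[k [p [p0 pE]]].
  rewrite -og_subr_ge0 => /colim_ge0P[l [q [q0 qE]]].
  have [m [im jm km lm]] := upper_bound4 i j k l.
  have : stage (sys_map S im x + sys_map S km p + sys_map S lm q
                - sys_map S jm y) = 0.
    rewrite linearB !linearD /= !stage_map -pE -qE.
    by rewrite [_ + (z - _)]addrC subrK [z + _]addrC subrK subrr.
  move=> /stage_eq0[n [mn]]; rewrite linearB !linearD /= => /eqP.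
  rewrite subr_eq0 => /eqP e.
  exists n, (sys_map S mn (sys_map S im x) + sys_map S mn (sys_map S km p)).
  split; last by rewrite linearD /= !stage_map -pE addrC subrK.
  have [_ _ _ convD _] := ogd_intervalP (S n).
  apply: (convD (sys_map S mn (sys_map S im x)) (sys_map S mn (sys_map S jm y))).
  + by do 2!apply: sys_map_interval.
  + by do 2!apply: sys_map_interval.
  + rewrite -og_subr_ge0 addrAC subrr add0r.
    by do 2!apply: sys_map_ge0.
  + rewrite -e -og_subr_ge0 addrAC subrr add0r.
    by do 2!apply: sys_map_ge0.
- move=> _ /colim_ge0P[i [x [x0 ->]]].
  have [_ _ _ _ /(_ x x0)[n [a [e [a0 De ->]]]]] := ogd_intervalP (S i).
  exists n, a, (fun j => stage (e j)); split=> // [j|].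
    by exists i, (e j).
  by rewrite linear_sum; apply: eq_bigr => j _; rewrite linearZ.
Qed.

Definition colim_ogd : ogd Γ := OGD colim_intervalP.

Fact stage_pos i : @stage i @` pos_cone (S i) `<=` pos_cone colim_ogd.
Proof. by move=> _ [x x0 <-]; exact: stage_ge0. Qed.

Fact stage_interval i :
  @stage i @` ogd_interval (S i) `<=` ogd_interval colim_ogd.
Proof. by move=> _ [x Dx <-]; exists i, x. Qed.

Definition stage_hom i : ogd_hom (S i) colim_ogd :=
  @OGDHom _ _ colim_ogd (@stage i) (@stage_pos i) (@stage_interval i).

Lemma stage_cocone : cocone stage_hom.
Proof. by move=> i j ij x; exact: stage_map. Qed.

Section ColimitUniversal.
Variables (L : ogd Γ) (c : forall i, ogd_hom (S i) L).
Hypothesis hc : cocone c.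

Definition colim_desc (u : colimit) : L := c (tag (repr u)) (tagged (repr u)).

Lemma colim_desc_stage i (x : S i) : colim_desc (stage x) = c i x.
Proof.
rewrite /colim_desc; set s := repr (stage x).
have : stage (tagged s) = stage x.
  by rewrite -[RHS]reprK /stage -/s; case: s.
case: s => j y /= /stage_eq_ge[k0 e].
have [k [jk ik k0k _]] := upper_bound4 j i k0 k0.
by rewrite -(hc jk) -(hc ik) /= (e k jk ik).
Qed.

Fact colim_desc_linear : linear colim_desc.
Proof.
move=> a u v; have [i [x [y [-> ->]]]] := stage_surj2 u v.
by rewrite -linearP !colim_desc_stage linearP.
Qed.
HB.instance Definition _ :=
  GRing.isLinear.Build ZΓ colim_ogd L *:%R colim_desc colim_desc_linear.

Fact colim_desc_pos : colim_desc @` pos_cone colim_ogd `<=` pos_cone L.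
Proof.
move=> _ [_ /colim_ge0P[i [x [x0 ->]]] <-]; rewrite colim_desc_stage.
by apply: (@ogd_map_pos _ _ _ (c i)); exists x.
Qed.

Fact colim_desc_interval :
  colim_desc @` ogd_interval colim_ogd `<=` ogd_interval L.
Proof.
move=> _ [_ [i [x [Dx ->]]] <-]; rewrite colim_desc_stage.
by apply: (@ogd_map_interval _ _ _ (c i)); exists x.
Qed.

Definition colim_desc_hom : ogd_hom colim_ogd L :=
  @OGDHom _ colim_ogd L colim_desc colim_desc_pos colim_desc_interval.

End ColimitUniversal.

End Colimit.

Fact ogd_comp_pos (Γ : groupType) (A B C : ogd Γ) (f : ogd_hom B C)
  (g : ogd_hom A B) : (f \o g) @` pos_cone A `<=` pos_cone C.
Proof.
move=> _ [x x0 <-]; apply: (ogd_map_pos (o := f)); exists (g x) => //.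
by apply: (ogd_map_pos (o := g)); exists x.
Qed.

Fact ogd_comp_interval (Γ : groupType) (A B C : ogd Γ) (f : ogd_hom B C)
  (g : ogd_hom A B) : (f \o g) @` ogd_interval A `<=` ogd_interval C.
Proof.
move=> _ [x x0 <-]; apply: (ogd_map_interval (o := f)); exists (g x) => //.
by apply: (ogd_map_interval (o := g)); exists x.
Qed.

Definition ogd_comp (Γ : groupType) (A B C : ogd Γ) (f : ogd_hom B C)
    (g : ogd_hom A B) : ogd_hom A C :=
  @OGDHom _ A C (f \o g)
    (@ogd_comp_pos _ _ _ _ f g) (@ogd_comp_interval _ _ _ _ f g).

Fact ogd_id_pos (Γ : groupType) (A : ogd Γ) : idfun @` pos_cone A `<=` pos_cone A.
Proof. by move=> _ [x x0 <-]. Qed.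

Fact ogd_id_interval (Γ : groupType) (A : ogd Γ) :
  idfun @` ogd_interval A `<=` ogd_interval A.
Proof. by move=> _ [x x0 <-]. Qed.

Definition ogd_id (Γ : groupType) (A : ogd Γ) : ogd_hom A A :=
  @OGDHom _ A A idfun (@ogd_id_pos _ A) (@ogd_id_interval _ A).

(** The colimit of germs has these properties by construction.  The universal
    property maps [L] to it, and [colim_desc] maps it back to [L]; the composite
    is the identity of [L] by uniqueness, which carries the first two properties
    over to [L]. *)
Lemma direct_limit_stages (Γ : groupType) (d : Order.disp_t) (I : preorderType d)
    (S : inductive_system Γ I) (L : ogd Γ) :
  directed_set I -> is_direct_limit S L ->
  exists c : forall i, ogd_hom (S i) L,
    [/\ cocone c,
        forall g, exists i (x : S i), g = c i x,
        forall g, 0 <= g -> exists i (x : S i), 0 <= x /\ g = c i x &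
        forall i (x : S i), c i x = 0 ->
          exists j (ij : (i <= j)%O), sys_map S ij x = 0].
Proof.
move=> hI [c hc univ]; exists c.
have [h hE _] := univ _ _ (stage_cocone hI (S := S)).
pose k := colim_desc_hom hI hc.
have kh g : k (h g) = g.
  have [e _ uniq] := univ _ _ hc.
  rewrite -[LHS]/(ogd_comp k h g) (uniq (ogd_comp k h)).
    by rewrite -(uniq (ogd_id L)).
  by move=> i x /=; rewrite (hE i x : h (c i x) = _) /= colim_desc_stage.
have hs i (x : S i) : h (c i x) = stage hI x by exact: (hE i x).
split=> // [g|g g0|i x cx0].
- have [i [x hg]] := stage_surj (h g); exists i, x.
  by rewrite -[g]kh hg /= colim_desc_stage.
- have /colim_ge0P[i [x [x0 hg]]] : 0 <= h g.
    by apply: (ogd_map_pos (o := h)); exists g.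
  by exists i, x; split=> //; rewrite -[g]kh hg /= colim_desc_stage.
by apply: (@stage_eq0 _ _ _ hI); rewrite -hs cx0 linear0.
Qed.

(** * Simplicial groups and their limits *)

Section SimplicialGroups.
Variables (Γ : groupType) (Δ : set Γ) (G : orderedGroupType Γ).
Hypotheses (nΔ : normal_subgroup Δ) (sG : simplicial_group Δ G).
Local Notation ZΓ := (group_ring Γ).

Lemma simplicial_bounded (x : G) : exists2 y, 0 <= y & x <= y.
Proof.
case: sG => [G0|[n [e [_ _ dirG]]]]; first by exists 0; rewrite ?(G0 x).
by have [z [_ xz z0]] := dirG x 0 I I; exists z.
Qed.

(** On the orbit of a basis element, [δ g e = g (g^-1 δ g) e = g e]; directedness
    makes every element a difference of two elements of the cone. *)
Lemma simplicial_stab : Δ `<=` Stab [set: G].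
Proof.
move=> δ Δδ x _; case: sG => [G0|[n [e [[_ stab_e _] coneE _]]]].
  by rewrite [LHS]G0 [RHS]G0.
have cone_stab (y : G) : 0 <= y -> gr_of δ *: y = y.
  move=> y0; have [a _ ->] : simplicial_cone Δ e y by rewrite -coneE.
  rewrite scaler_sumr; apply: eq_bigr => j _.
  move: (a j); apply: gr_ind => [|b c IHb IHc|g].
  - by rewrite scale0r scaler0.
  - by rewrite scalerBl scalerBr IHb IHc.
  have : Δ (g^-1 * δ * g)%g.
    by case: nΔ => _ _ _ ΔJ; rewrite -{2}[g]invgK; exact: ΔJ.
  rewrite -(stab_e j) => /(_ (e j) erefl) {2}<-.
  by rewrite !scalerA -!gr_ofM !mulgA mulgV mul1g.
have [y y0 le_xy] := simplicial_bounded x.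
rewrite -[x](subKr y) scalerBr !cone_stab //.
by rewrite og_subr_ge0.
Qed.

(** Decompose along the basis.  The given coefficients have only nonnegative
    projections; lifting these projections back to [Z[Γ]] gives nonnegative
    coefficients with the same action.  Independence of the basis is stated for
    coefficients with nonnegative projection, so the resulting relation is split
    into its positive and negative parts. *)
Lemma simplicial_decomposition : decomposition_property Δ G.
Proof.
move=> n a x x0 ax0; case: sG => [G0|[p [e [[_ stab_e indep] coneE _]]]].
  exists 0%N, (fun _ _ => 0), (fun _ => 0); split=> [i []|[]|i|[]] //.
  by rewrite [LHS]G0 [RHS]G0.
have [Δ1 _ _ _] := nΔ.
have e0 j : 0 <= e j.
  have : simplicial_cone Δ e (e j).
    exists (fun i => if i == j then 1 else 0) => [i|].
      by apply: nneg_perm_proj; case: eqP => _; [exact: nnegU|exact: nneg0].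
    rewrite (bigD1 j) //= eqxx scale1r big1 ?addr0 // => i /negPf->.
    by rewrite scale0r.
  by rewrite -coneE.
have /choice[b bP] : forall i, exists b : 'I_p -> ZΓ,
    (forall j, nneg (b j)) /\ x i = \sum_j b j *: e j.
  move=> i.
  have [b b0 ->] : simplicial_cone Δ e (x i) by rewrite -coneE; exact: x0.
  exists (fun j => coset_lift (perm_proj Δ (b j))).
  split=> [j|]; first exact: nneg_coset_lift.
  apply: eq_bigr => j _; apply/eqP; rewrite -subr_eq0 -scalerBl; apply/eqP.
  apply: (perm_proj_ker Δ1 simplicial_stab) => //.
  by rewrite (raddfB (perm_proj Δ)) /= coset_liftK subrr.
exists p, b, e; split=> // [i j|i|].
- by case: (bP i).
- by case: (bP i).
pose s j := \sum_i a i * b i j.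
have /choice[q /choice[r qrP]] : forall j, exists q r : ZΓ,
    [/\ nneg q, nneg r & s j = q - r] by move=> j; exact: gr_nneg_decomp.
have [|j|/(_ _) kerE _] := indep q r.
- by move=> j; apply: nneg_perm_proj; case: (qrP j).
- by apply: nneg_perm_proj; case: (qrP j).
move=> j; rewrite -(raddf_sum (perm_proj Δ)) -/(s j).
have [_ _ ->] := qrP j; apply: kerE.
apply/eqP; rewrite -subr_eq0 -sumrB -[X in _ == X]ax0; apply/eqP.
rewrite (eq_bigr (fun j => \sum_i a i *: (b i j *: e j))) => [|k _].
  rewrite exchange_big; apply: eq_bigr => i _ /=.
  by rewrite -scaler_sumr; case: (bP i) => _ <-.
have [_ _ qrE] := qrP k; rewrite -scalerBl -qrE scaler_suml.
by apply: eq_bigr => i _; rewrite scalerA.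
Qed.

End SimplicialGroups.

Section SimplicialLimits.
Variables (Γ : groupType) (Δ : set Γ) (d : Order.disp_t) (I : preorderType d).
Variables (S : inductive_system Γ I) (L : ogd Γ).
Hypotheses (hI : directed_set I) (nΔ : normal_subgroup Δ).
Hypothesis sS : forall i : I, simplicial_group Δ (S i).
Hypothesis limL : is_direct_limit S L.

Lemma limit_bounded (x : L) : exists2 y, 0 <= y & x <= y.
Proof.
have [c [_ surj _ _]] := direct_limit_stages hI limL; have [i [z ->]] := surj x.
have [y y0 zy] := simplicial_bounded (sS i) z.
have c_ge0 w : 0 <= w -> 0 <= c i w.
  by move=> w0; apply: (ogd_map_pos (o := c i)); exists w.
exists (c i y); first exact: c_ge0.
by rewrite -og_subr_ge0 -linearB c_ge0 // og_subr_ge0.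
Qed.

Lemma limit_stab : Δ `<=` Stab [set: L].
Proof.
have [c [_ surj _ _]] := direct_limit_stages hI limL.
move=> δ Δδ x _; have [i [z ->]] := surj x.
by rewrite -linearZ /= (simplicial_stab nΔ (sS i) Δδ).
Qed.

(** A relation of [L] holds at some stage, where it is decomposed; the
    decomposition is then pushed to [L]. *)
Lemma limit_decomposition : decomposition_property Δ L.
Proof.
have [c [hc _ pos inj]] := direct_limit_stages hI limL.
move=> n a x x0 ax0.
have /choice[s sP] : forall i, exists s : {k : I & S k},
    0 <= tagged s /\ x i = c (tag s) (tagged s).
  by move=> i; have [k [y [y0 ->]]] := pos _ (x0 i); exists (existT _ k y).
have [k sk] := directed_set_bound hI (fun i => tag (s i)).
pose y i := sys_map S (sk i) (tagged (s i)).
have xE i : x i = c k (y i) by case: (sP i) => _ ->; rewrite -(hc _ _ (sk i)).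
have y0 i : 0 <= y i by apply: sys_map_ge0; case: (sP i).
have [l [kl ay0]] : exists l (kl : (k <= l)%O),
    sys_map S kl (\sum_i a i *: y i) = 0.
  apply: inj; rewrite linear_sum -[RHS]ax0; apply: eq_bigr => i _.
  by rewrite linearZ /= xE.
have [||m [b [z [b0 z0 yE ab0]]]] :=
  simplicial_decomposition nΔ (sS l) (a := a) (x := fun i => sys_map S kl (y i)).
- by move=> i; exact: sys_map_ge0.
- by rewrite -[RHS]ay0 linear_sum; apply: eq_bigr => i _; rewrite linearZ.
exists m, b, (fun j => c l (z j)); split=> // [j|i].
  by apply: (ogd_map_pos (o := c l)); exists (z j) => //; exact: z0.
rewrite xE -(hc _ _ kl) /= yE linear_sum; apply: eq_bigr => j _.
by rewrite linearZ.
Qed.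

End SimplicialLimits.

Theorem propositionB3 (Γ : groupType) (Δ : set Γ) (hΔ : normal_subgroup Δ)
    (GD : ogd Γ) (d : Order.disp_t) (I : preorderType d)
    (hI : directed_set I) (S : inductive_system Γ I)
    (hS : forall i : I, simplicial_group Δ (S i))
    (hlim : is_direct_limit S GD) :
  exists (H : orderedGroupType Γ) (u : H),
    [/\ og_extension (ogd_interval GD) u (perm_base Δ),
        SDP Δ H &
        Δ `<=` Stab [set: H]].
Proof.
have Δ1 : Δ 1%g by case: hΔ.
have stabG := limit_stab hI hΔ hS hlim.
have bdG := limit_bounded hI hS hlim.
exists (unitization (ogd_intervalP GD) Δ1 stabG), (unitization_one _ _ _); split.
- exact: unitization_og_extension.
- by apply: unitization_SDP => //; exact: limit_decomposition hI hΔ hS hlim.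
- exact: unitization_stab.
Qed.
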